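(* Let $\mathcal{X}$ be a complex Banach space and let $A,B\in\mathcal{B}(\mathcal{X})$. If $r$ is a rational function with poles off $\sigma(A)\cup\sigma(B)$, then $$\mathscr{R}(\delta_{r(A),r(B)})\subseteq\mathscr{R}(\delta_{A,B})\quad\text{and}\quad\mathscr{N}(\delta_{r(A),r(B)})\supseteq\mathscr{N}(\delta_{A,B}).$$
   Context: $\mathcal{B}(\mathcal{X})$ is the Banach algebra of all bounded linear operators on $\mathcal{X}$; $\sigma(A)$ is the spectrum of $A$. For $A,B\in\mathcal{B}(\mathcal{X})$, the generalized derivation $\delta_{A,B}\colon\mathcal{B}(\mathcal{X})\to\mathcal{B}(\mathcal{X})$ is $\delta_{A,B}(X)=AX-XB$. $\mathscr{N}(T)$ and $\mathscr{R}(T)$ denote the null space and the range of $T$. If $r(z)=p(z)/q(z)$ with polynomials $p,q$ and poles off $\sigma(A)\cup\sigma(B)$, then $r(A)=p(A)q(A)^{-1}$ and $r(B)=p(B)q(B)^{-1}$. *)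

(* Defs.v *)
From HB Require Import structures.
From mathcomp Require Import all_boot all_order all_algebra.
From mathcomp Require Import generic_quotient.
From mathcomp Require Import all_classical all_reals.
From mathcomp Require Import topology normedtype.
From mathcomp Require Import complex.

Set Implicit Arguments.
Unset Strict Implicit.
Unset Printing Implicit Defensive.

Import Order.TTheory GRing.Theory Num.Theory.
Import numFieldNormedType.Exports.

Local Open Scope classical_set_scope.
Local Open Scope ring_scope.

Section BoundedOperators.
Context {K : numFieldType} {X : normedModType K}.

(* For K = C the order is partial: [`|f x| <= M * `|x|] forces [M * `|x|] to be
   real, so allowing M : K is the usual notion of boundedness. *)
Definition bounded_linear : {pred (X -> X)} :=
  [pred f | `[< linear f /\ exists M : K, forall x, `|f x| <= M * `|x| >]].

Lemma bounded_linearP (f : X -> X) :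
  reflect (linear f /\ exists M : K, forall x, `|f x| <= M * `|x|)
          (f \in bounded_linear).
Proof. exact: asboolP. Qed.

Lemma bounded_linear_submod_closed : submod_closed bounded_linear.
Proof.
split=> [|a f g /bounded_linearP[lf [M hM]] /bounded_linearP[lg [N hN]]].
  apply/bounded_linearP; split.
    by move=> a x y /=; rewrite scaler0 addr0.
  by exists 0 => x /=; rewrite normr0 mul0r.
have fgE x : (a *: f + g) x = a *: f x + g x by [].
apply/bounded_linearP; split.
  by move=> c x y; rewrite !fgE lf lg !scalerDr !scalerA [a * c]mulrC addrACA.
exists (`|a| * M + N) => x.
rewrite fgE (le_trans (ler_normD _ _))// mulrDl lerD// normrZ -mulrA.
by rewrite ler_wpM2l.
Qed.

HB.instance Definition _ :=
  GRing.isSubmodClosed.Build K (X -> X) bounded_linear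
    bounded_linear_submod_closed.

End BoundedOperators.

(* The algebra B(X).  It is not an [algType]: that structure excludes the zero
   ring, which is B(X) when X = 0. *)
Record bounded_op (K : numFieldType) (X : normedModType K) := BoundedOp {
  bounded_op_fun :> X -> X ;
  _ : bounded_op_fun \in bounded_linear }.

Section BoundedOpAlgebra.
Context {K : numFieldType} {X : normedModType K}.

HB.instance Definition _ := [isSub for @bounded_op_fun K X].
HB.instance Definition _ := [Choice of bounded_op X by <:].
HB.instance Definition _ := [SubChoice_isSubLmodule of bounded_op X by <:].

Implicit Types S T U : bounded_op X.

Lemma bounded_opP T : linear T /\ exists M : K, forall x, `|T x| <= M * `|x|.
Proof. exact/bounded_linearP/(valP T). Qed.

Lemma bounded_op_ge0 T :
  exists2 M : K, 0 <= M & forall x, `|T x| <= M * `|x|.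
Proof.
have [_ [M hM]] := bounded_opP T; exists `|M| => // x.
by rewrite (le_trans (hM x))// -[`|x| in X in _ <= X]normr_id -normrM ger0_norm//
  (le_trans _ (hM x)).
Qed.

Lemma bounded_op_linear T : linear T.
Proof. by case: (bounded_opP T). Qed.

Lemma bounded_op_eqP S T : S =1 T -> S = T.
Proof. by move=> h; apply/val_inj/funext. Qed.

Lemma bounded_op1_subproof : idfun \in @bounded_linear K X.
Proof. by apply/bounded_linearP; split=> //; exists 1 => x; rewrite mul1r. Qed.

Lemma bounded_opM_subproof S T : S \o T \in @bounded_linear K X.
Proof.
have [[M M0 hM] [N N0 hN]] := (bounded_op_ge0 S, bounded_op_ge0 T).
apply/bounded_linearP; split => [a x y|] /=; first by rewrite !bounded_op_linear.
exists (M * N) => x; rewrite (le_trans (hM _))// -mulrA.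
by rewrite ler_wpM2l.
Qed.

Definition bounded_op1 : bounded_op X := BoundedOp bounded_op1_subproof.
Definition bounded_opM S T : bounded_op X := BoundedOp (bounded_opM_subproof S T).

Fact bounded_opMA : associative bounded_opM.
Proof. by move=> S T U; apply: bounded_op_eqP. Qed.
Fact bounded_op1M : left_id bounded_op1 bounded_opM.
Proof. by move=> T; apply: bounded_op_eqP. Qed.
Fact bounded_opM1 : right_id bounded_op1 bounded_opM.
Proof. by move=> T; apply: bounded_op_eqP. Qed.
Fact bounded_opMDl : left_distributive bounded_opM +%R.
Proof. by move=> S T U; apply: bounded_op_eqP. Qed.
Fact bounded_opMDr : right_distributive bounded_opM +%R.
Proof.
move=> S T U; apply: bounded_op_eqP => x /=.
by have := bounded_op_linear S 1 (T x) (U x); rewrite !scale1r.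
Qed.

HB.instance Definition _ := GRing.Zmodule_isPzRing.Build (bounded_op X)
  bounded_opMA bounded_op1M bounded_opM1 bounded_opMDl bounded_opMDr.

Definition op_inverse T : set (bounded_op X) := [set S | T * S = 1 /\ S * T = 1].

Definition op_invertible T : Prop := op_inverse T !=set0.

(* Only meaningful when [T] is invertible in B(X); a junk value otherwise. *)
Definition op_inv T : bounded_op X := xget 0 (op_inverse T).

Definition spectrum T : set K := [set z | ~ op_invertible (T - z *: (1 : bounded_op X))].

Definition op_horner (p : {poly K}) T : bounded_op X :=
  \sum_(i < size p) p`_i *: T ^+ i.

Definition gen_derivation (A B T : bounded_op X) : bounded_op X :=
  A * T - T * B.

Definition op_range (D : bounded_op X -> bounded_op X) : set (bounded_op X) :=
  range D.

Definition op_null (D : bounded_op X -> bounded_op X) : set (bounded_op X) :=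
  [set T | D T = 0].

End BoundedOpAlgebra.

Section RationalFunctions.
Context {K : numFieldType}.
Implicit Type r : {fraction {poly K}}.

(* Numerator and denominator of a rational function in lowest terms. *)
Definition rat_num r : {poly K} :=
  \n_(repr r) %/ gcdp \n_(repr r) \d_(repr r).
Definition rat_den r : {poly K} :=
  \d_(repr r) %/ gcdp \n_(repr r) \d_(repr r).

Definition poles r : set K := [set z | root (rat_den r) z].

Definition op_rat {X : normedModType K} r (T : bounded_op X) : bounded_op X :=
  op_horner (rat_num r) T * op_inv (op_horner (rat_den r) T).

End RationalFunctions.

Section FunctionalCalculus.
Context {K : numClosedFieldType} {X : normedModType K}.
Implicit Types (S T U : bounded_op X) (p q : {poly K}).

Lemma bounded_opMZl (c : K) S T : (c *: S) * T = c *: (S * T).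
Proof. exact: bounded_op_eqP. Qed.

Lemma bounded_opMZr (c : K) S T : S * (c *: T) = c *: (S * T).
Proof.
apply: bounded_op_eqP => x; have hS := bounded_op_linear S.
have S0 : S 0 = 0.
  apply/eqP; have /eqP := hS 1 0 0.
  by rewrite !scale1r addr0 -subr_eq0 opprD addNKr oppr_eq0.
have := hS c (T x) 0.
by rewrite S0 !addr0.
Qed.

Lemma op_horner_widen p T n : (size p <= n)%N ->
  op_horner p T = \sum_(i < n) p`_i *: T ^+ i.
Proof.
move=> pn; rewrite /op_horner (big_ord_widen n (fun i => p`_i *: T ^+ i))//.
rewrite big_mkcond; apply: eq_bigr => i _; case: ltnP => // pi.
by rewrite nth_default// scale0r.
Qed.

Lemma op_hornerD p q T : op_horner (p + q) T = op_horner p T + op_horner q T.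
Proof.
set n := maxn (size p) (size q).
rewrite !(@op_horner_widen _ _ n) ?leq_maxl ?leq_maxr ?size_polyD// -big_split.
by apply: eq_bigr => i _; rewrite coefD scalerDl.
Qed.

Lemma op_hornerC (c : K) T : op_horner c%:P T = c *: (1 : bounded_op X).
Proof.
by rewrite (@op_horner_widen _ _ 1) ?size_polyC_leq1// big_ord1 coefC expr0.
Qed.

Lemma op_hornerMX p T : op_horner (p * 'X) T = op_horner p T * T.
Proof.
have [->|p0] := eqVneq p 0.
  by rewrite mul0r /op_horner size_poly0 !big_ord0 mul0r.
rewrite /op_horner size_mulX// big_ord_recl coefMX scale0r add0r mulr_suml.
by apply: eq_bigr => i _; rewrite coefMX bounded_opMZl -exprSr.
Qed.

Lemma op_horner_comm p T : op_horner p T * T = T * op_horner p T.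
Proof.
rewrite mulr_suml mulr_sumr; apply: eq_bigr => i _.
by rewrite bounded_opMZl bounded_opMZr -exprSr exprS.
Qed.

Lemma op_hornerM p q T : op_horner (p * q) T = op_horner p T * op_horner q T.
Proof.
elim/poly_ind: p => [|p c IH].
  by rewrite mul0r /op_horner size_poly0 !big_ord0 mul0r.
rewrite mulrDl -mulrA ['X * q]mulrC mulrA !op_hornerD !op_hornerMX IH.
rewrite mulrDl -!mulrA op_horner_comm op_hornerC bounded_opMZl mul1r.
congr (_ + _).
have [->|c0] := eqVneq c 0.
  by rewrite mul0r scale0r /op_horner size_poly0 big_ord0.
rewrite mul_polyC /op_horner size_scale// scaler_sumr.
by apply: eq_bigr => i _; rewrite coefZ scalerA.
Qed.

Lemma op_invP T : op_invertible T -> T * op_inv T = 1 /\ op_inv T * T = 1.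
Proof. by move=> -[S hS]; apply: (@xgetPex _ 0 (op_inverse T)); exists S. Qed.

Lemma op_invertibleM S T :
  op_invertible S -> op_invertible T -> op_invertible (S * T).
Proof.
move=> [S' [SS' S'S]] [T' [TT' T'T]]; exists (T' * S'); split.
  by rewrite -mulrA [T * _]mulrA TT' mul1r.
by rewrite -mulrA [S' * _]mulrA S'S mul1r.
Qed.

Lemma op_horner_invertible q T : q != 0 ->
    (forall z, z \in spectrum T -> ~~ root q z) ->
  op_invertible (op_horner q T).
Proof.
move=> q0; have [s qE] := closed_field_poly_normal q; rewrite {}qE in q0 *.
have l0 : lead_coef q != 0 by apply: contra_neq q0 => ->; rewrite scale0r.
rewrite -mul_polyC.
move: (lead_coef q) l0 => l l0 {q q0}; elim: s => [|a s IH] hs.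
  rewrite big_nil mulr1 op_hornerC; exists (l^-1 *: (1 : bounded_op X)).
  by split; rewrite bounded_opMZl bounded_opMZr scalerA ?mulfV ?mulVf// mul1r
    scale1r.
rewrite big_cons mulrCA op_hornerM; apply: op_invertibleM; last first.
  apply: IH => z /hs; rewrite big_cons mulrCA rootM negb_or => /andP[_ //].
rewrite op_hornerD -[X in op_horner X]mul1r op_hornerMX -polyCN -polyC1.
rewrite !op_hornerC scale1r mul1r scaleNr.
have : ~ spectrum T a.
  move=> /mem_set/hs; rewrite big_cons mulrCA rootM negb_or => /andP[].
  by rewrite root_XsubC eqxx.
by rewrite /spectrum /= => /contrapT.
Qed.

Lemma rat_den_neq0 (r : {fraction {poly K}}) : rat_den r != 0.
Proof. by rewrite /rat_den dvdp_div_eq0 ?dvdp_gcdr// denom_ratioP. Qed.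

Lemma rat_numdenE (r : {fraction {poly K}}) p q : q != 0 ->
  r = FracField.tofrac p / FracField.tofrac q -> rat_num r * q = rat_den r * p.
Proof.
move=> q0 rE; set n := \n_(repr r); set d := \d_(repr r).
have d0 : d != 0 := denom_ratioP _.
have ndE : n * q = d * p.
  have /eqmodP/eqP : (repr r = Ratio p q %[mod {fraction {poly K}}])%qT.
    rewrite reprK rE; unlock FracField.tofrac.
    rewrite -[_^-1]FracField.pi_inv -[LHS]FracField.pi_mul.
    rewrite /FracField.mulf /FracField.invf.
    by rewrite !numden_Ratio ?oner_neq0 ?mulr1 ?mul1r.
  by rewrite !numden_Ratio.
have g0 : gcdp n d != 0 by rewrite gcdp_eq0 negb_and d0 orbT.
apply: (mulIf g0); rewrite mulrAC [RHS]mulrAC.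
by rewrite /rat_num /rat_den !divpK ?dvdp_gcdl ?dvdp_gcdr.
Qed.

Lemma coprimep_rat (r : {fraction {poly K}}) : coprimep (rat_num r) (rat_den r).
Proof.
by rewrite /rat_num /rat_den coprimep_div_gcd// denom_ratioP orbT.
Qed.

(* r(T) may be computed from any representation of r, reduced or not, whose
   denominator does not vanish on the spectrum. *)
Lemma op_ratE (r : {fraction {poly K}}) p q T : q != 0 ->
    (forall z, z \in spectrum T -> ~~ root q z) ->
    r = FracField.tofrac p / FracField.tofrac q ->
  op_rat r T = op_horner p T * op_inv (op_horner q T).
Proof.
move=> q0 qT rE; have pqE := rat_numdenE q0 rE.
have dq : rat_den r %| q.
  rewrite -(@Gauss_dvdpr _ _ (rat_num r)) 1?coprimep_sym ?coprimep_rat//.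
  by rewrite pqE dvdp_mulr.
have dT z : z \in spectrum T -> ~~ root (rat_den r) z.
  by move=> /qT; apply: contra => dz; exact: root_dvdp dq dz.
have [qi _] := op_invP (op_horner_invertible q0 qT).
have [di di'] := op_invP (op_horner_invertible (rat_den_neq0 r) dT).
set P := op_horner p T; set Q := op_horner q T.
set N := op_horner (rat_num r) T; set D := op_horner (rat_den r) T.
have DNQ : D * P = N * Q by rewrite -!op_hornerM pqE.
have DP : D * P = P * D by rewrite -!op_hornerM mulrC.
have DN : D * N = N * D by rewrite -!op_hornerM mulrC.
have {}DN : op_inv D * N = N * op_inv D.
  by rewrite -[RHS]mul1r -di' !mulrA -(mulrA _ D N) DN -!mulrA di mulr1.
rewrite /op_rat -/N -/D -DN -[P]mul1r -di' -[_ * D * P]mulrA DNQ.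
by rewrite -!mulrA qi mulr1.
Qed.

End FunctionalCalculus.

(* Main.v *)
Require Import Defs.
From mathcomp Require Import all_boot all_order all_algebra.
From mathcomp Require Import all_classical all_reals.
From mathcomp Require Import topology normedtype.
From mathcomp Require Import complex.

Local Open Scope classical_set_scope.
Local Open Scope ring_scope.
Local Open Scope complex_scope.

Import GRing.Theory.

(** The pairs [(s, t)] with [s] commuting with [a], [t] commuting with [b], and
    [R(delta_{s,t})] contained in [R(delta_{a,b})], [N(delta_{a,b})] contained
    in [N(delta_{s,t})], are closed under componentwise sums, products and
    inverses, because [delta_{s s', t t'}(x) = s delta_{s',t'}(x) +
    delta_{s,t}(x) t'] and [delta_{s^-1,t^-1}(x) = - s^-1 delta_{s,t}(x) t^-1].
    They contain [(a, b)] and the scalars, hence [(r(a), r(b))]. *)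

Section SubordinatePairs.
Context {R : pzRingType} (a b : R).
Implicit Types s t x y : R.

(** The commutation clauses let [s] and [t] move past [a] and [b]: [s * (a * y - y * b) * t = a * (s
    * y * t) - (s * y * t) * b]. This keeps the range clause stable under products and inverses. *)
Definition subordinate s t : Prop :=
  [/\ GRing.comm s a, GRing.comm t b,
      forall x, exists y, s * x - x * t = a * y - y * b &
      forall x, a * x = x * b -> s * x = x * t].

Lemma subordinate_refl : subordinate a b.
Proof. by split=> // x; exists x. Qed.

Lemma subordinateD {s t s' t'} :
  subordinate s t -> subordinate s' t' -> subordinate (s + s') (t + t').
Proof.
move=> [sa tb rng ker] [sa' tb' rng' ker']; split.
- by rewrite /GRing.comm mulrDl mulrDr sa sa'.
- by rewrite /GRing.comm mulrDl mulrDr tb tb'.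
- move=> x; have [[y xy] [y' xy']] := (rng x, rng' x); exists (y + y').
  by rewrite !(mulrDl, mulrDr) opprD addrACA xy xy' opprD addrACA.
- by move=> x abx; rewrite mulrDl mulrDr ker// ker'.
Qed.

Lemma subordinateM {s t s' t'} :
  subordinate s t -> subordinate s' t' -> subordinate (s * s') (t * t').
Proof.
move=> [sa tb rng ker] [sa' tb' rng' ker']; split.
- by rewrite /GRing.comm -mulrA sa' !mulrA sa.
- by rewrite /GRing.comm -mulrA tb' !mulrA tb.
- move=> x; have [[y xy] [y' xy']] := (rng x, rng' x).
  (* Left multiplication by [s] and right multiplication by [t'] commute with [delta_{a,b}], so they
     carry over to the preimages [y'] and [y]. *)
  exists (s * y' + y * t').
  have -> : s * s' * x - x * (t * t') =
      s * (s' * x - x * t') + (s * x - x * t) * t'.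
    by rewrite mulrBr mulrBl !mulrA addrA subrK.
  rewrite xy xy' mulrBr mulrBl mulrDr mulrDl opprD addrACA.
  by rewrite !mulrA sa -(mulrA y t' b) tb' !mulrA.
- by move=> x abx; rewrite -mulrA ker'// mulrA ker// mulrA.
Qed.

Lemma comm_inv {s s' x} :
  s * s' = 1 -> s' * s = 1 -> GRing.comm s x -> GRing.comm s' x.
Proof.
move=> ss' s's sx; rewrite /GRing.comm.
by rewrite -[LHS]mulr1 -ss' !mulrA -(mulrA s' x s) -sx mulrA s's mul1r.
Qed.

Lemma subordinateV {s t s' t'} :
  s * s' = 1 -> s' * s = 1 -> t * t' = 1 -> t' * t = 1 ->
  subordinate s t -> subordinate s' t'.
Proof.
move=> ss' s's tt' t't [sa tb rng ker].
have s'a := comm_inv ss' s's sa; have t'b := comm_inv tt' t't tb.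
have invE x : s' * x - x * t' = - (s' * (s * x - x * t) * t').
  rewrite mulrBr mulrBl !mulrA s's mul1r -(mulrA (s' * x)) tt' mulr1.
  by rewrite opprB.
split=> // x.
  have [y xy] := rng x; exists (- (s' * y * t')).
  rewrite invE xy mulrN mulNr -opprD; congr (- _).
  by rewrite mulrBr mulrBl !mulrA s'a -!(mulrA (s' * y)) t'b.
move=> /ker stx; apply/eqP; rewrite -subr_eq0 invE stx subrr.
by rewrite mulr0 mul0r oppr0.
Qed.

End SubordinatePairs.

Section RationalCalculus.
Context {K : numClosedFieldType} {X : normedModType K} (A B : bounded_op X).

(** Scalars are central, so [delta_{c,c}] vanishes identically and [0] serves as preimage. *)
Lemma subordinate_scalar (c : K) :
  subordinate A B (c *: (1 : bounded_op X)) (c *: (1 : bounded_op X)).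
Proof.
by split=> [||x|x _]; rewrite /GRing.comm ?bounded_opMZl ?bounded_opMZr
  ?mul1r ?mulr1//; exists 0; rewrite mulr0 mul0r !subrr.
Qed.

(** Horner induction: passing from [p] to [p * 'X + c%:P] takes one product with the pair [(A, B)]
    and one sum with a scalar pair. *)
Lemma subordinate_horner (p : {poly K}) :
  subordinate A B (op_horner p A) (op_horner p B).
Proof.
elim/poly_ind: p => [|p c IH].
  by rewrite -polyC0 !op_hornerC; exact: subordinate_scalar.
rewrite !op_hornerD !op_hornerMX !op_hornerC.
apply: subordinateD (subordinate_scalar c).
exact: subordinateM IH (subordinate_refl _ _).
Qed.

Lemma subordinate_rat {r : {fraction {poly K}}} :
  poles r `&` (spectrum A `|` spectrum B) = set0 ->
  subordinate A B (op_rat r A) (op_rat r B).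
Proof.
move=> /disjoints_subset offr.
(* No root of the reduced denominator lies in either spectrum, so [op_inv] below yields true
   inverses, not its default value. *)
have off (T : bounded_op X) : spectrum T `<=` spectrum A `|` spectrum B ->
    op_invertible (op_horner (rat_den r) T).
  move=> TAB; apply: op_horner_invertible (rat_den_neq0 r) _ => z /set_mem/TAB.
  by move=> zAB; apply/negP => /offr.
have [qA Aq] := op_invP (off A (@subsetUl _ _ _)).
have [qB Bq] := op_invP (off B (@subsetUr _ _ _)).
apply: subordinateM (subordinate_horner _) _.
exact: subordinateV qA Aq qB Bq (subordinate_horner _).
Qed.

End RationalCalculus.

Theorem lemma6 (R : realType) (X : completeNormedModType R[i])
    (A B : bounded_op X) (r : {fraction {poly R[i]}})
    (poles_off : poles r `&` (spectrum A `|` spectrum B) = set0) :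
  op_range (gen_derivation (op_rat r A) (op_rat r B))
    `<=` op_range (gen_derivation A B) /\
  op_null (gen_derivation A B)
    `<=` op_null (gen_derivation (op_rat r A) (op_rat r B)).
Proof.
(* The last two clauses give the two inclusions, [D T = 0] being read as an intertwining
   relation. *)
have [_ _ rng ker] := subordinate_rat _ _ poles_off.
split=> [_ [T _ <-]|T /eqP]; last first.
  by rewrite subr_eq0 => /eqP/ker rT; apply/eqP; rewrite subr_eq0 rT.
by have [Y TY] := rng T; exists Y.
Qed.
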